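(* Let $H=\sum_{\ell=0}^{L-1}h_\ell P_\ell$ be a Pauli-sum Hamiltonian on $n$ qubits, with $h_\ell\in\mathbb R$ and $P_\ell\in\{I,X,Y,Z\}^{\otimes n}$, and let $t\in\mathbb R$. Let $\mathcal A$ be a one-qubit ancilla register and define $$D_H(\tau)=|0\rangle\langle 0|_{\mathcal A}\otimes e^{\mathrm i\tau H}+|1\rangle\langle 1|_{\mathcal A}\otimes e^{-\mathrm i\tau H}\quad(\tau\in\mathbb R),\qquad V_H(t)=|0\rangle\langle0|_{\mathcal A}\otimes I+|1\rangle\langle1|_{\mathcal A}\otimes e^{-\mathrm itH}.$$ Then $$\bigl(I_{\mathcal A}\otimes e^{-\mathrm itH/2}\bigr)\,D_H(t/2)=V_H(t).$$
   Context: $I_{\mathcal A}$ is the identity on the ancilla qubit and $I$ (in $V_H$) is the identity on the $n$-qubit system register. $D_H$ is the signed controlled time evolution and $V_H$ the single-branch controlled time evolution. *)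

(* Defs.v *)
(* [R[i]] and the Kronecker product [A *t B] are those of mathcomp-real-closed. *)
From HB Require Import structures.
From mathcomp Require Import all_boot all_order all_algebra.
From mathcomp Require Import all_classical all_reals all_analysis.
From mathcomp Require Import complex mxtens.
Import numFieldNormedType.Exports.

Set Implicit Arguments.
Unset Strict Implicit.
Unset Printing Implicit Defensive.

Import Order.TTheory GRing.Theory Num.Theory.
Local Open Scope ring_scope.
Local Open Scope complex_scope.

Inductive pauli := PauliI | PauliX | PauliY | PauliZ.

(* The limit is taken in the topology that ['M[K]_m] inherits from the norm
   of [K], that is, entrywise.  It is used with [K = R[i]], normed by the
   modulus. *)
Definition expmx (K : numFieldType) (m : nat) (A : 'M[K]_m) : 'M[K]_m :=
  limn (series (fun k => (k`!%:R)^-1 *: A ^+ k)).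

Section Definitions.
Variable R : realType.

Definition pauli_mx (p : pauli) : 'M[R[i]]_2 :=
  match p with
  | PauliI => 1%:M
  | PauliX => delta_mx 0 1 + delta_mx 1 0
  | PauliY => - 'i%C *: delta_mx 0 1 + 'i%C *: delta_mx 1 0
  | PauliZ => delta_mx 0 0 - delta_mx 1 1
  end.

(* [expnS] has to be cast along because [2 ^ n.+1] is not convertible to
   [2 * 2 ^ n] for a variable [n]. *)
Fixpoint pauli_string (n : nat) : n.-tuple pauli -> 'M[R[i]]_(2 ^ n) :=
  match n with
  | 0 => fun _ => 1%:M
  | n'.+1 => fun s =>
      castmx (esym (expnS 2 n'), esym (expnS 2 n'))
        (pauli_mx (thead s) *t pauli_string [tuple of behead s])
  end.

Definition pauli_sum (n L : nat) (h : 'I_L -> R) (P : 'I_L -> n.-tuple pauli) :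
    'M[R[i]]_(2 ^ n) :=
  \sum_(l < L) (h l)%:C *: pauli_string (P l).

(* [delta_mx b b] is the projector [|b><b|] on the ancilla, which is
   the left tensor factor. *)
Definition signed_ctrl_evol (n : nat) (H : 'M[R[i]]_(2 ^ n)) (tau : R) :
    'M[R[i]]_(2 * 2 ^ n) :=
  (delta_mx 0 0 : 'M[R[i]]_2) *t expmx (('i%C * tau%:C) *: H) +
  (delta_mx 1 1 : 'M[R[i]]_2) *t expmx (- ('i%C * tau%:C) *: H).

Definition ctrl_evol (n : nat) (H : 'M[R[i]]_(2 ^ n)) (t : R) :
    'M[R[i]]_(2 * 2 ^ n) :=
  (delta_mx 0 0 : 'M[R[i]]_2) *t (1%:M : 'M[R[i]]_(2 ^ n)) +
  (delta_mx 1 1 : 'M[R[i]]_2) *t expmx (- ('i%C * t%:C) *: H).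

End Definitions.

(* Main.v *)
(** The partial sums [S a N] of the series of [e^(aH)] satisfy
    [S a N *m S b N - S (a + b) N =
     \sum_(j, k < N, j + k >= N) (a^j / j!) (b^k / k!) H^(j + k)].
    If [c] is the sum of the moduli of the entries of [H], then the entries of
    [H^k] are bounded by [c^k], so this double sum is dominated by the
    corresponding tail for the real numbers [|a| c] and [|b| c], which tends to
    [0] because the real exponential turns sums into products.  Hence
    [e^((a + b)H) = e^(aH) e^(bH)], and the two ancilla branches can be
    compared separately. *)
Require Import Defs.
From HB Require Import structures.
From mathcomp Require Import all_boot all_order all_algebra.
From mathcomp Require Import all_classical all_reals all_analysis.
From mathcomp Require Import complex mxtens ring.

Import Order.TTheory GRing.Theory Num.Theory.
Import numFieldNormedType.Exports.
Local Open Scope classical_set_scope.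
Local Open Scope ring_scope.
Local Open Scope complex_scope.

(** * Cauchy products of exponential partial sums *)

(** Both sides run over the triangle [j + k < N]: exchange the sums, then shift the inner index by
    [k = n - j]. *)
Lemma sum_antidiag (V : nmodType) (g : nat -> nat -> V) N :
  \sum_(n < N) \sum_(j < n.+1) g j (n - j)%N =
  \sum_(j < N) \sum_(k < N | (j + k < N)%N) g j k.
Proof.
transitivity (\sum_(n < N) \sum_(j < N | (j < n.+1)%N) g j (n - j)%N).
  by apply: eq_bigr => n _; rewrite (big_ord_widen N (fun j => g j (n - j)%N)).
rewrite (exchange_big_dep predT) //=; apply: eq_bigr => j _.
rewrite -(big_mkord (fun n => (j < n.+1)%N) (fun n => g j (n - j)%N)).
rewrite -(big_mkord (fun k => (j + k < N)%N) (fun k => g j k)).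
rewrite -(big_nat_widenl _ _ _ predT) // -{1}(add0n j) big_addn.
rewrite (big_nat_widen _ _ N) ?leq_subr //.
apply: eq_big => [k|k _] /=; first by rewrite ltn_subRL.
by rewrite addnK.
Qed.

(** The sequence [e] stands for the powers: [GRing.exp H] gives the matrix series and the constant
    [1] the real one, so that one identity serves both. *)
Definition exp_sum (K : fieldType) (V : lmodType K) (e : nat -> V) (a : K) N :=
  \sum_(n < N) (a ^+ n / n`!%:R) *: e n.

(** The binomial theorem, resummed along antidiagonals. *)
Lemma exp_sumD (K : numFieldType) (V : lmodType K) (e : nat -> V) (a b : K) N :
  exp_sum K V e (a + b) N =
  \sum_(j < N) \sum_(k < N | (j + k < N)%N)
     (a ^+ j / j`!%:R * (b ^+ k / k`!%:R)) *: e (j + k)%N.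
Proof.
rewrite -(sum_antidiag V
  (fun j k => (a ^+ j / j`!%:R * (b ^+ k / k`!%:R)) *: e (j + k)%N)).
rewrite /exp_sum; apply: eq_bigr => n _.
rewrite addrC exprDn mulr_suml scaler_suml.
apply: eq_bigr => j _; have jn : (j <= n)%N by rewrite -ltnS.
rewrite subnKC //; congr (_ *: _).
(* Factoring [n!] as ['C(n, j) * (j! * (n - j)!)] lets the binomial coefficient cancel. *)
rewrite -(bin_fact jn) !natrM -mulr_natr.
have bin_neq0 : 'C(n, j)%:R != 0 :> K by rewrite pnatr_eq0 -lt0n bin_gt0.
by rewrite !invfM [LHS]mulrA (mulfK bin_neq0) [_ * a ^+ _]mulrC mulrACA.
Qed.

(** The square [j, k < N] splits into the triangle [j + k < N], which is [exp_sumD], and its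
    complement. *)
Lemma exp_sum_mul_sub (K : numFieldType) (V : lmodType K) (e : nat -> V)
    (a b : K) N :
  \sum_(j < N) \sum_(k < N)
     (a ^+ j / j`!%:R * (b ^+ k / k`!%:R)) *: e (j + k)%N
   - exp_sum K V e (a + b) N =
  \sum_(j < N) \sum_(k < N | ~~ (j + k < N)%N)
     (a ^+ j / j`!%:R * (b ^+ k / k`!%:R)) *: e (j + k)%N.
Proof.
rewrite exp_sumD -sumrB; apply: eq_bigr => j _.
by rewrite (bigID (fun k : 'I_N => (j + k < N)%N)) /= addrAC subrr add0r.
Qed.

(** * Limits of matrices *)

(** Expanding in the basis [delta_mx i j] turns the limit into a finite sum of scalar limits. *)
Lemma cvg_mx (K : numFieldType) (m n : nat) (T : Type) (F : set_system T)
    (FF : Filter F) (f : T -> 'M[K]_(m, n)) (A : 'M[K]_(m, n)) :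
  (forall i j, f x i j @[x --> F] --> A i j) -> f x @[x --> F] --> A.
Proof.
move=> fA; rewrite (matrix_sum_delta A).
under eq_fun do rewrite (matrix_sum_delta (f _)).
apply: cvg_big => [|i _]; first exact: add_continuous.
apply: cvg_big => [|j _]; first exact: add_continuous.
exact: cvgZr_tmp.
Qed.

Lemma cvg_mulmx (K : numFieldType) (m n p : nat) (T : Type) (F : set_system T)
    (FF : Filter F) (f : T -> 'M[K]_(m, n)) (g : T -> 'M[K]_(n, p))
    (A : 'M[K]_(m, n)) (B : 'M[K]_(n, p)) :
  f x @[x --> F] --> A -> g x @[x --> F] --> B ->
  (f x *m g x) @[x --> F] --> A *m B.
Proof.
move=> fA gB; apply: cvg_mx => i j; rewrite mxE.
under eq_fun do rewrite mxE.
apply: cvg_big => [|k _]; first exact: add_continuous.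
by apply: cvgM; apply: (continuous_cvg _ (@coord_continuous _ _ _ _ _ _)).
Qed.


Lemma mulmx_lim_unique (K : numFieldType) (m : nat) (T : Type)
    (F : set_system T) (FF : ProperFilter F)
    (f g h : T -> 'M[K]_m) (A B C : 'M[K]_m) :
  f x @[x --> F] --> A -> g x @[x --> F] --> B -> h x @[x --> F] --> C ->
  (f x *m g x - h x) @[x --> F] --> (0 : 'M[K]_m) -> C = A *m B.
Proof.
move=> fA gB hC fgh0; apply/esym/subr0_eq.
apply: (cvg_unique (@norm_hausdorff _ _) _ fgh0).
by apply: cvgB; [exact: cvg_mulmx|].
Qed.

(* The topology of [R[i]] is inferred only once it is cast to [numFieldType]. *)
Local Notation numC R := (R[i] : numFieldType).

(** * Complex series dominated by real ones *)

Lemma norm_real_complex (R : realType) (x : R) : `|x%:C| = `|x|%:C :> R[i].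
Proof. by rewrite normc_def /= expr0n /= addr0 sqrtr_sqr. Qed.

Lemma real_complex_continuous (R : realType) :
  continuous (fun x : R => x%:C : numC R).
Proof.
move=> x; apply/cvgrPdist_lt => e e0.
(* A positive element of [R[i]] is real, so the estimate can be made in [R]. *)
have eE : e = (complex.Re e)%:C by rewrite RRe_real // gtr0_real.
have Re0 : 0 < complex.Re e by rewrite -ltcR -eE.
near=> y; rewrite -rmorphB /= norm_real_complex eE ltcR.
by near: y; move: (complex.Re e) Re0; apply/cvgrPdist_lt.
Unshelve. all: by end_near. Qed.

(** The modulus bounds the real and imaginary parts, so the real comparison test applies to each of
    them. *)
Lemma is_cvg_series_complex (R : realType) (u : nat -> numC R) (v : nat -> R) :
  (forall n, `|u n| <= (v n)%:C) -> cvgn (series v) -> cvgn (series u).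
Proof.
move=> uv cv.
have dominated_cvg (w : nat -> R) :
    (forall n, `|w n| <= v n) -> cvgn (series w).
  move=> wv; apply: normed_cvg; apply: series_le_cvg cv => n //=.
  exact: le_trans (wv n).
have ReIm n : `|complex.Re (u n)| <= v n /\ `|complex.Im (u n)| <= v n.
  split; rewrite -lecR; apply: le_trans (uv n).
    exact: normc_ge_Re.
  rewrite normc_def lecR -sqrtr_sqr ler_wsqrtr //.
  by rewrite lerDr sqr_ge0.
have cRe := dominated_cvg _ (fun n => (ReIm n).1).
have cIm := dominated_cvg _ (fun n => (ReIm n).2).
have -> : series u = (fun n =>
    ((series (fun n => complex.Re (u n)) n)%:C : numC R)
    + ('i%C : numC R) * (series (fun n => complex.Im (u n)) n)%:C).
  apply/funext => n; rewrite /series /= !rmorph_sum mulr_sumr -big_split /=.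
  by apply: eq_bigr => k _; rewrite [LHS]complexE.
apply: is_cvgD; last apply: is_cvgMr.
  apply: cvgP; exact: (continuous_cvg _ (@real_complex_continuous _ _) cRe).
apply: cvgP; exact: (continuous_cvg _ (@real_complex_continuous _ _) cIm).
Qed.

(** * Convergence of the matrix exponential *)

Lemma norm_exprmx_le (R : realType) (m : nat) (H : 'M[R[i]]_m) :
  exists2 c : R, 0 <= c &
    forall (k : nat) (i j : 'I_m), `|(H ^+ k) i j| <= (c ^+ k)%:C.
Proof.
pose s := \sum_i \sum_j `|H i j|.
have s0 : 0 <= s by do 2 apply: sumr_ge0 => ? _.
have sE : (complex.Re s)%:C = s by rewrite RRe_real // ger0_real.
have c0 : 0 <= complex.Re s by rewrite -lecR sE.
exists (complex.Re s) => //; elim=> [|k IH] i j.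
  by rewrite expr0 mxE; case: eqP => _; rewrite ?normr1 ?normr0 ?lexx ?ler01.
rewrite exprS mxE (le_trans (ler_norm_sum _ _ _)) // exprS rmorphM /= sE.
apply: (@le_trans _ _ (\sum_l `|H i l| * (complex.Re s ^+ k)%:C)).
  by apply: ler_sum => l _; rewrite normrM ler_wpM2l.
rewrite -mulr_suml ler_wpM2r //; first by rewrite ler0c exprn_ge0.
(* The moduli in row [i] form one summand of [s]. *)
by rewrite /s [leRHS](bigD1 i) //= lerDl; do 2 apply: sumr_ge0 => ? _.
Qed.

Lemma exprmxZ (R : comPzRingType) (m : nat) (a : R) (A : 'M[R]_m) k :
  (a *: A) ^+ k = a ^+ k *: A ^+ k.
Proof.
elim: k => [|k IH]; first by rewrite !expr0 scale1r.
by rewrite !exprS IH -!mulmxE -scalemxAl -scalemxAr scalerA.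
Qed.

Lemma series_expmxE (K : numFieldType) (m : nat) (a : K) (A : 'M[K]_m) :
  series (fun k => (k`!%:R)^-1 *: (a *: A) ^+ k) = exp_sum K _ (GRing.exp A) a.
Proof.
apply/funext => N; rewrite /series /= big_mkord /exp_sum.
by apply: eq_bigr => k _; rewrite exprmxZ scalerA mulrC.
Qed.

Lemma exp_sum_coeff (R : realType) (x : R) :
  exp_sum R R^o (fun=> 1) x = series (exp_coeff x).
Proof.
apply/funext => N; rewrite /series /= big_mkord /exp_sum.
by apply: eq_bigr => k _; rewrite [LHS]mulr1.
Qed.

(** As [expmx] is a [limn], it is the limit of its series only once convergence is known. Each entry
    is dominated by the real exponential series at [|a| c]. *)
Lemma cvg_exp_sum_expmx (R : realType) (m : nat) (a : R[i]) (H : 'M[R[i]]_m) :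
  exp_sum R[i] _ (GRing.exp H) a N @[N --> \oo] --> expmx (a *: H).
Proof.
rewrite /expmx -series_expmxE.
have [c _ Hc] := norm_exprmx_le _ _ H.
have aE : `|a| = (complex.Re `|a|)%:C by rewrite RRe_real // ger0_real.
have cvg_entry i j :
    cvgn (series (fun k => ((a ^+ k / k`!%:R) *: H ^+ k) i j : numC R)).
  have := is_cvg_series_exp_coeff (complex.Re `|a| * c).
  apply: is_cvg_series_complex.
  move=> k; rewrite mxE /exp_coeff /= !normrM normfV normrX.
  rewrite [X in X^-1]ger0_norm ?ler0n // exprMn !rmorphM fmorphV rmorph_nat.
  rewrite rmorphXn /= -aE.
  by rewrite mulrAC ler_wpM2r ?invr_ge0 ?ler0n // ler_wpM2l ?exprn_ge0.
suff : cvgn (exp_sum R[i] _ (GRing.exp H) a) by rewrite -series_expmxE.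
apply: (cvgP (\matrix_(i, j)
  limn (series (fun k => ((a ^+ k / k`!%:R) *: H ^+ k) i j : numC R)))).
apply: cvg_mx => i j; rewrite mxE.
under eq_fun do rewrite summxE
  -(big_mkord predT (fun k => ((a ^+ k / k`!%:R) *: H ^+ k) i j)).
exact: cvg_entry.
Qed.

Lemma cvg_exp_tail (R : realType) (x y : R) :
  \sum_(j < N) \sum_(k < N | ~~ (j + k < N)%N)
     (x ^+ j / j`!%:R * (y ^+ k / k`!%:R)) @[N --> \oo] --> (0 : R).
Proof.
have E N : \sum_(j < N) \sum_(k < N | ~~ (j + k < N)%N)
     (x ^+ j / j`!%:R * (y ^+ k / k`!%:R)) =
   series (exp_coeff x) N * series (exp_coeff y) N
     - series (exp_coeff (x + y)) N.
  (* With [e] constantly [1], [exp_sum_mul_sub] applies to scalars. *)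
  transitivity (\sum_(j < N) \sum_(k < N | ~~ (j + k < N)%N)
      (x ^+ j / j`!%:R * (y ^+ k / k`!%:R)) *: (1 : R^o)).
    by do 2 apply: eq_bigr => ? _; rewrite [RHS]mulr1.
  rewrite -(exp_sum_mul_sub R R^o (fun=> 1)) exp_sum_coeff; congr (_ - _).
  rewrite /series /= !big_mkord big_distrlr /=.
  by do 2 apply: eq_bigr => ? _; exact: mulr1.
suff : (series (exp_coeff x) N * series (exp_coeff y) N
    - series (exp_coeff (x + y)) N) @[N --> \oo] -->
    expR x * expR y - expR (x + y).
  by under eq_fun do rewrite -E; rewrite expRD subrr.
by apply: cvgB; [apply: cvgM|]; exact: is_cvg_series_exp_coeff.
Qed.

(** * The exponential law *)

Lemma expmxD (R : realType) (m : nat) (a b : R[i]) (H : 'M[R[i]]_m) :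
  expmx ((a + b) *: H) = expmx (a *: H) *m expmx (b *: H).
Proof.
pose S z N : 'M[numC R]_m := exp_sum R[i] _ (GRing.exp H) z N.
have cS z : S z N @[N --> \oo] --> (expmx (z *: H) : 'M[numC R]_m).
  exact: cvg_exp_sum_expmx.
have cSS : (S a N *m S b N - S (a + b) N) @[N --> \oo] --> (0 : 'M[numC R]_m).
  have [c _ Hc] := norm_exprmx_le _ _ H.
  have normE (z : R[i]) : `|z| = (complex.Re `|z|)%:C.
    by rewrite RRe_real // ger0_real.
  pose tail N := \sum_(j < N) \sum_(k < N | ~~ (j + k < N)%N)
    ((complex.Re `|a| * c) ^+ j / j`!%:R *
     ((complex.Re `|b| * c) ^+ k / k`!%:R)).
  have tail_ge N i j : `|(S a N *m S b N - S (a + b) N) i j| <= (tail N)%:C.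
    have -> : S a N *m S b N - S (a + b) N =
        \sum_(j < N) \sum_(k < N | ~~ (j + k < N)%N)
          (a ^+ j / j`!%:R * (b ^+ k / k`!%:R)) *: H ^+ (j + k)%N.
      rewrite -exp_sum_mul_sub; congr (_ - _).
      rewrite mulmx_suml; apply: eq_bigr => p _.
      rewrite mulmx_sumr; apply: eq_bigr => q _.
      by rewrite -scalemxAl -scalemxAr scalerA exprD.
    rewrite summxE (le_trans (ler_norm_sum _ _ _)) // /tail rmorph_sum /=.
    apply: ler_sum => p _; rewrite summxE (le_trans (ler_norm_sum _ _ _)) //.
    rewrite rmorph_sum /=; apply: ler_sum => q _; rewrite mxE !normrM !normfV.
    rewrite !normrX !normr_nat !exprMn.
    (* Collecting the powers of [c] isolates [c ^+ (p + q)], the bound for the entries of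
       [H ^+ (p + q)]. *)
    rewrite [X in _ <= X%:C](_ : _ = complex.Re `|a| ^+ p / p`!%:R *
      (complex.Re `|b| ^+ q / q`!%:R) * c ^+ (p + q)); last first.
      by rewrite exprD mulrACA; ring.
    rewrite !rmorphM /= !fmorphV !rmorph_nat !rmorphXn /= -!normE.
    rewrite ler_wpM2l ?mulr_ge0 ?exprn_ge0 ?invr_ge0 ?ler0n //.
    by rewrite -rmorphXn.
  apply: cvg_mx => i j; rewrite mxE; apply/cvgr0Pnorm_lt => e e0.
  have eE : e = (complex.Re e)%:C by rewrite RRe_real // gtr0_real.
  have Re0 : 0 < complex.Re e by rewrite -ltcR -eE.
  near=> N; rewrite (le_lt_trans (tail_ge N i j)) // eE ltcR.
  rewrite (le_lt_trans (ler_norm _)) //; near: N.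
  by move: (complex.Re e) Re0; apply/cvgr0Pnorm_lt; exact: cvg_exp_tail.
exact: (mulmx_lim_unique R[i] m nat \oo _ _ _ _ _ _ _
  (cS a) (cS b) (cS (a + b)) cSS).
Unshelve. all: by end_near. Qed.

Lemma expmx0 (R : realType) (m : nat) : expmx (0 : 'M[R[i]]_m) = 1%:M.
Proof.
apply: (cvg_lim (@norm_hausdorff _ _)).
rewrite -(scale0r (0 : 'M[R[i]]_m)) series_expmxE.
(* The partial sum is empty for [N = 0] and equals the identity from [N = 1] on. *)
apply: cvg_near_cst; near=> N.
rewrite /exp_sum -(@prednK N); last by near: N; exists 1%N.
rewrite big_ord_recl /= expr0 fact0 invr1 mulr1 scale1r expr0 big1 ?addr0 //.
by move=> k _; rewrite expr0n /= mul0r scale0r.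
Unshelve. all: by end_near. Qed.

(** * Comparison of the ancilla branches *)

Lemma tensmx_mul_branches (K : comPzRingType) (m n : nat) (P Q : 'M[K]_m)
    (E A B : 'M[K]_n) :
  (1%:M *t E) *m (P *t A + Q *t B) = P *t (E *m A) + Q *t (E *m B).
Proof. by rewrite mulmxDr !tensmx_mul !mul1mx. Qed.

Theorem mainTheorem5 (R : realType) (n L : nat)
    (h : 'I_L -> R) (P : 'I_L -> n.-tuple pauli) (t : R) :
  let H : 'M[R[i]]_(2 ^ n) := pauli_sum h P in
  ((1%:M : 'M[R[i]]_2) *t expmx (- ('i%C * t%:C / 2) *: H))
    *m signed_ctrl_evol H (t / 2)
  = ctrl_evol H t.
Proof.
move=> H.
have half : (t / 2)%:C = t%:C / 2 :> R[i] by rewrite rmorphM fmorphV rmorph_nat.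
pose E (z : R[i]) := expmx (z *: H).
pose z := 'i%C * t%:C : R[i].
(* On branch [0] the two half-time evolutions cancel; on branch [1] they add up to the full time
   [t]. *)
have EN : E (- (z / 2)) *m E ('i%C * (t / 2)%:C) = 1%:M.
  by rewrite -expmxD half mulrA addNr scale0r expmx0.
have E2 : E (- (z / 2)) *m E (- ('i%C * (t / 2)%:C)) = E (- z).
  by rewrite -expmxD half mulrA -opprD -splitr.
apply: (etrans (tensmx_mul_branches _ _ _ _ _ _ _ _)).
exact: (f_equal2 (fun A B => delta_mx 0 0 *t A + delta_mx 1 1 *t B) EN E2).
Qed.
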